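(* There exists $\varepsilon > 0$ such that $r_n \le 1 - \varepsilon$ for all integers $n \ge 2$.
   Context: $\mathbb{B}^n$ is the closed Euclidean unit ball in $\mathbb{R}^n$, and $\mathrm{Vol}$ is $n$-dimensional volume (Lebesgue measure). A convex body in $\mathbb{R}^n$ is a compact convex set with nonempty interior. A convex body $K\subset\mathbb{R}^n$ has constant width $w$ if the length of the orthogonal projection of $K$ onto any line is equal to $w$. A body $K \subset \mathbb{R}^n$ has effective radius $r$ if $\mathrm{Vol}(K) = \mathrm{Vol}(r\mathbb{B}^n)$. The number $r_n$ denotes the smallest effective radius of a body of constant width $2$ in $\mathbb{R}^n$. *)

(* Defs.v *)
From HB Require Import structures.
From mathcomp Require Import all_boot all_order all_algebra.
From mathcomp Require Import all_classical all_reals all_analysis.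

Set Implicit Arguments.
Unset Strict Implicit.
Unset Printing Implicit Defensive.

Import Order.TTheory GRing.Theory Num.Theory.
Import numFieldNormedType.Exports.

Local Open Scope classical_set_scope.
Local Open Scope ring_scope.

(* The norm that the library puts on row vectors is the sup norm: it induces
   the usual topology, hence the right notions of compactness and interior,
   but the Euclidean metric has to be given separately. *)
Definition dotv (R : realType) (n : nat) (x y : 'rV[R]_n) : R :=
  \sum_(i < n) x ord0 i * y ord0 i.

Definition enorm (R : realType) (n : nat) (x : 'rV[R]_n) : R :=
  Num.sqrt (dotv x x).

Definition unit_eball (R : realType) (n : nat) : set 'rV[R]_n :=
  [set x | enorm x <= 1].

Definition scale_set (R : realType) (n : nat) (r : R) (A : set 'rV[R]_n) :
    set 'rV[R]_n :=
  [set r *: x | x in A].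

(* Product of n copies of the Lebesgue measure on the line, carried by
   n-tuples, which have the product sigma-algebra; the empty product is the
   unit mass at the empty tuple.  Sets that are not Borel get no meaningful
   value. *)
Fixpoint lebesgue_tuple (R : realType) (n : nat) :
    set (n.-tuple (measurableTypeR R)) -> \bar R :=
  match n return set (n.-tuple (measurableTypeR R)) -> \bar R with
  | 0 => dirac [tuple]
  | m.+1 =>
      pushforward (product_measure1 (@lebesgue_measure R) (@lebesgue_tuple R m))
        (fun p : measurableTypeR R * m.-tuple (measurableTypeR R) =>
           [tuple of p.1 :: p.2])
  end.

Definition vol (R : realType) (n : nat) (A : set 'rV[R]_n) : \bar R :=
  lebesgue_tuple [set t : n.-tuple (measurableTypeR R) |
                   A (\row_(i < n) (tnth t i : R))].

Definition convex_body (R : realType) (n : nat) (K : set 'rV[R]_n) : Prop :=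
  [/\ compact K, convex_set K & interior K !=set0].

(* Orthogonal projection onto the line p + R u, for a unit vector u. *)
Definition line_proj (R : realType) (n : nat) (p u x : 'rV[R]_n) : 'rV[R]_n :=
  p + dotv (x - p) u *: u.

(* One-dimensional Lebesgue measure of the part of S on the line p + R u,
   for a unit vector u; t |-> p + t u is then an isometry onto the line. *)
Definition line_length (R : realType) (n : nat) (p u : 'rV[R]_n)
    (S : set 'rV[R]_n) : \bar R :=
  lebesgue_measure [set t : measurableTypeR R | S (p + (t : R) *: u)].

Definition constant_width (R : realType) (n : nat) (w : R)
    (K : set 'rV[R]_n) : Prop :=
  convex_body K /\
  forall p u : 'rV[R]_n, enorm u = 1 ->
    line_length p u (line_proj p u @` K) = w%:E.

Definition effective_radius (R : realType) (n : nat) (K : set 'rV[R]_n)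
    (r : R) : Prop :=
  0 <= r /\ vol K = vol (scale_set r (@unit_eball R n)).

(* The infimum is over a nonempty set of nonnegative reals (it contains the
   effective radius 1 of the unit ball) for n > 0, and it is attained by
   Blaschke's selection theorem. *)
Definition min_effective_radius (R : realType) (n : nat) : R :=
  inf [set r : R | exists K : set 'rV[R]_n,
                     constant_width 2 K /\ effective_radius K r].

(* Main.v *)
From HB Require Import structures.
Require Import Defs.
From mathcomp Require Import all_boot all_order all_algebra.
From mathcomp Require Import all_classical all_reals all_analysis.
From mathcomp Require Import measurable_realfun ring lra.

(** Every nonempty set [L] of diameter at most 2 lies in a maximal one [K]; by
    maximality [K] is the set of points within distance 2 of all its points,
    and such a set has constant width 2.  In particular [K] is contained in
    the intersection [M] of the balls of radius 2 centered in [L], so it is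
    enough to choose [L] with [M] small.

    In high dimension (Arman, Bondarenko, Nazarov, Prymak, Radchenko) [L] is
    the part of the ball of radius [sqrt 2] in the positive orthant.  Unless
    it lies in that orthant, a point of [M] with positive part of norm [a] and
    negative part of norm [b] satisfies [a^2 + (b + sqrt 2)^2 <= 4].  The
    region of those [(a, b)] is covered by two ellipses
    [a^2/A^2 + b^2/B^2 <= 1] with [A + B = 39/20].  On each orthant such an ellipse is a linear image of the
    ball, so summing over the orthants the points it describes have volume
    [((A + B)/2)^n Vol(B)].  Hence [Vol(K) <= 2 (39/40)^n Vol(B)].

    In each remaining dimension only [Vol(K) < Vol(B)] is needed.  There [L]
    is an apex together with a unit sphere of codimension 2, so that [M] is a
    Reuleaux triangle rotated about its axis; the chords of [M] parallel to
    the axis are strictly shorter than the chords of the unit ball at the same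
    distance from the axis. *)

Import Order.TTheory GRing.Theory Num.Theory.
Import numFieldNormedType.Exports.
Local Open Scope classical_set_scope.
Local Open Scope ring_scope.

Set Implicit Arguments.
Unset Strict Implicit.
Unset Printing Implicit Defensive.

(** * Volumes as iterated integrals *)

Section Integral.
Context d (T : measurableType d) (R : realType).
Variable mu : {measure set T -> \bar R}.
Local Open Scope ereal_scope.
Import HBNNSimple.

(* No measurability is assumed: the integral of a nonnegative function is the
   supremum of the integrals of the simple functions below it.  This makes
   [vol] monotone on all sets, so that the measurability of the bodies of
   constant width is never needed. *)
Lemma ge0_le_integral_nomeas (f g : T -> \bar R) :
  (forall x, 0 <= f x) -> (forall x, f x <= g x) ->
  \int[mu]_x f x <= \int[mu]_x g x.
Proof.
move=> f0 fg.
rewrite !ge0_integralTE//; last by move=> x; exact: le_trans (f0 x) (fg x).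
apply: ge_ereal_sup => _ [h /= hf] <-.
by apply: ereal_sup_ubound; exists h => // x; exact: le_trans (hf x) (fg x).
Qed.

(** The nonnegative difference [g - f] has integral 0 only if it vanishes almost everywhere, which
    fails on [D]; finite integrals allow cancellation. *)
Lemma ge0_lt_integral (D : set T) (f g : T -> \bar R) :
  measurable_fun setT f -> measurable_fun setT g ->
  (forall x, 0 <= f x) -> (forall x, f x < +oo) -> (forall x, f x <= g x) ->
  measurable D -> 0 < mu D -> (forall x, D x -> f x < g x) ->
  \int[mu]_x g x < +oo -> \int[mu]_x f x < \int[mu]_x g x.
Proof.
move=> mf mg f0 ffin fg mD D0 ltfg gfin.
have fnum x : f x \is a fin_num by rewrite ge0_fin_numE.
have h0 x : 0 <= g x - f x by rewrite sube_ge0 ?fnum ?fg.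
have mh : measurable_fun setT (fun x => g x - f x) by exact: emeasurable_funB.
have gE : \int[mu]_x g x = \int[mu]_x f x + \int[mu]_x (g x - f x).
  rewrite -ge0_integralD//; apply: eq_integral => x _.
  by rewrite addeC subeK.
have If : \int[mu]_x f x \is a fin_num.
  rewrite ge0_fin_numE ?integral_ge0//; apply: le_lt_trans gfin.
  exact: ge0_le_integral_nomeas.
rewrite gE lteDl// lt0e integral_ge0 ?andbT//; apply/eqP => h_eq0.
have : \int[mu]_x `|g x - f x| = 0.
  by rewrite -h_eq0; apply: eq_integral => x _; rewrite gee0_abs.
move=> /(ae_eq_integral_abs _ measurableT mh)[N [mN N0 subN]].
suff : mu D <= mu N by rewrite N0 leNgt D0.
apply: le_measure; rewrite ?inE// => x Dx; apply: subN => /= /(_ I) /eqP.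
by rewrite gt_eqF// sube_gt0 ltfg.
Qed.

End Integral.

Section IteratedVolume.
Variable R : realType.
Local Notation mu := (@lebesgue_measure R).

Definition row_cons n (t : R) (x : 'rV[R]_n) : 'rV[R]_n.+1 :=
  \row_i oapp (x ord0) t (unlift ord0 i).

Lemma row_cons0 n t (x : 'rV[R]_n) : row_cons t x ord0 ord0 = t.
Proof. by rewrite mxE unlift_none. Qed.

Lemma row_consS n t (x : 'rV[R]_n) i :
  row_cons t x ord0 (lift ord0 i) = x ord0 i.
Proof. by rewrite mxE liftK. Qed.

(** The product measure is by definition the integral of the measures of sections, so slicing by the
    first coordinate is valid for every set. *)
Lemma volS n (A : set 'rV[R]_n.+1) :
  vol A = (\int[mu]_t vol [set x | A (row_cons t x)])%E.
Proof.
rewrite /vol /= /pushforward /product_measure1; apply: eq_integral => t _ /=.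
congr lebesgue_tuple; apply/seteqP; split => x /=; rewrite /xsection/= inE/=.
  suff -> : \row_i tnth [tuple of t :: x] i = row_cons t (\row_i tnth x i) by [].
  apply/rowP => i; rewrite !mxE; case: unliftP => [j ->|->]/=.
    by rewrite tnthS mxE.
  by rewrite tnth0.
suff -> : \row_i tnth [tuple of t :: x] i = row_cons t (\row_i tnth x i) by [].
apply/rowP => i; rewrite !mxE; case: unliftP => [j ->|->]/=.
  by rewrite tnthS mxE.
by rewrite tnth0.
Qed.

Lemma vol0 (A : set 'rV[R]_0) (x : 'rV[R]_0) : vol A = (\1_A x)%:E.
Proof.
rewrite /vol /= diracE; congr (_%:R)%:E; congr nat_of_bool.
have xE : \row_(i < 0) (tnth [tuple] i : R) = x by rewrite [LHS]thinmx0 [x]thinmx0.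
by apply/idP/idP; rewrite !inE/= xE.
Qed.

Lemma vol_ge0 n (A : set 'rV[R]_n) : (0 <= vol A)%E.
Proof.
elim: n A => [|n IH] A; first by rewrite (vol0 A 0) lee_fin.
by rewrite volS; apply: integral_ge0 => t _.
Qed.

Lemma vol_le n (A B : set 'rV[R]_n) : A `<=` B -> (vol A <= vol B)%E.
Proof.
elim: n A B => [|n IH] A B AB.
  rewrite !(vol0 _ 0) lee_fin !indicE ler_nat.
  by case: (boolP (0 \in A)) => [/set_mem /AB /mem_set ->|].
rewrite !volS; apply: ge0_le_integral_nomeas => t; first exact: vol_ge0.
by apply: IH => x /=; exact: AB.
Qed.

(** Superlevel sets of a monotone function are intervals. Volumes of slices are monotone in the
    level, which is how their measurability is obtained. *)
Lemma emonotone_measurable (f : R -> \bar R) :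
  {homo f : x y / x <= y >-> (x <= y)%E} -> measurable_fun setT f.
Proof.
move=> f_nd; apply: (measurability (@ErealGenCInfty.G R)) => [|/= _ [_] [r] -> <-].
  exact: ErealGenCInfty.measurableE.
apply: measurableI => //; apply: is_interval_measurable => s t/=.
rewrite !in_itv/= !andbT => fs ft u /andP[su ut].
by rewrite in_itv/= andbT (le_trans fs)// f_nd.
Qed.

Lemma eantitone_measurable (f : R -> \bar R) :
  {homo f : x y / x <= y >-> (y <= x)%E} -> measurable_fun setT f.
Proof.
move=> f_ni; rewrite (_ : f = (fun x => f (- x)) \o -%R); last first.
  by apply/funext => x; rewrite /= opprK.
apply: measurableT_comp; last exact: oppr_measurable.
by apply: emonotone_measurable => x y xy; apply: f_ni; rewrite lerN2.
Qed.

(** Slicing a sublevel set of such a sum by a coordinate gives one of the same form, a dimension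
    lower. Balls and stretched balls are of this form. *)
Definition wsum (w : R -> R) n (x : 'rV[R]_n) := \sum_i w (x ord0 i).

Lemma wsumS w n t (x : 'rV[R]_n) : wsum w (row_cons t x) = w t + wsum w x.
Proof.
rewrite /wsum big_ord_recl row_cons0; congr (_ + _).
by apply: eq_bigr => i _; rewrite row_consS.
Qed.

Definition wvol (w : R -> R) n (s : R) :=
  vol [set x : 'rV[R]_n | wsum w x <= s].

Lemma wvol0 w s : wvol w 0 s = ((0 <= s)%R%:R)%:E.
Proof.
rewrite /wvol (vol0 _ 0) indicE; congr (_%:R)%:E; congr nat_of_bool.
by apply/idP/idP; rewrite inE /= /wsum big_ord0.
Qed.

Lemma wvolS w n s : wvol w n.+1 s = (\int[mu]_t wvol w n (s - w t)%R)%E.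
Proof.
rewrite /wvol volS; apply: eq_integral => t _; congr vol.
by apply/funext => x /=; rewrite wsumS lerBrDl.
Qed.

Lemma wvol_homo w n : {homo wvol w n : x y / x <= y >-> (x <= y)%E}.
Proof. by move=> x y xy; apply: vol_le => z /= /le_trans; exact. Qed.

Lemma measurable_wvolB w n (s : R) :
  measurable_fun setT (fun t : R => wvol w n (s - t)).
Proof.
apply: eantitone_measurable => x y xy; apply: wvol_homo.
by rewrite lerD2l lerN2.
Qed.

(** * Stretching the two half-lines *)

Definition stretch (A B t : R) := if 0 < t then t / A else t / B.

(** The pushforward divided by [A] gives each []a, b]] its length, so it is Lebesgue measure by
    uniqueness. *)
Lemma lebesgue_measure_scale (A : R) (E : set R) : 0 < A -> measurable E ->
  pushforward mu (fun t : measurableTypeR R => t / A : measurableTypeR R) E =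
  (A%:E * mu E)%E.
Proof.
move=> A0 mE.
have mA : measurable_fun setT
    (fun t : measurableTypeR R => t / A : measurableTypeR R).
  exact: mulrr_measurable.
pose phi (t : measurableTypeR R) : measurableTypeR R := t / A.
have Ai : 0 <= A^-1 by rewrite invr_ge0 ltW.
pose A1 : {nonneg R} := NngNum Ai.
pose nu0 : {measure set (measurableTypeR R) -> \bar R} :=
  mscale A1 (pushforward mu phi).
pose nu := nu0 mA.
have -> : mu E = nu E.
  apply: (@lebesgue_measure_unique R nu) => // _ [[a b]] _ <-.
  rewrite /nu /nu0 /= /mscale /= /pushforward /=.
  rewrite (_ : _ @^-1` _ = `]a * A, b * A]%classic); last first.
    apply/seteqP; split => t /=; rewrite !in_itv/= ltr_pdivlMr// ler_pdivrMr//.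
  rewrite !lebesgue_measure_itv/= !lte_fin ltr_pM2r//.
  case: ifPn => _; last by rewrite mule0.
  by rewrite -!EFinB -EFinM -mulrBl mulrC mulfK ?gt_eqF.
by rewrite /nu /nu0 /= /mscale /= muleA -EFinM mulfV ?gt_eqF// mul1e.
Qed.

Lemma integral_scale (A : R) (D : set R) (f : R -> \bar R) :
  0 < A -> measurable D -> (forall t, D (t / A) <-> D t) ->
  measurable_fun setT f -> (forall t, 0 <= f t)%E ->
  (\int[mu]_(t in D) f (t / A)%R = A%:E * \int[mu]_(t in D) f t)%E.
Proof.
move=> A0 mD DA mf f0.
have mA : measurable_fun setT
    (fun t : measurableTypeR R => t / A : measurableTypeR R).
  exact: mulrr_measurable.
pose phi (t : measurableTypeR R) : measurableTypeR R := t / A.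
have DE : D = phi @^-1` D by apply/seteqP; split => t /=; apply DA.
rewrite [in LHS]DE.
have := @ge0_integral_pushforward _ _ _ _ R _ mA mu D f mD
  (measurable_funTS mf) (fun _ _ => f0 _).
move=> E; rewrite -[LHS]E {E}.
pose A' : {nonneg R} := NngNum (ltW A0).
rewrite -[A%:E]/(A'%:num%:E) -ge0_integral_mscale//; last exact: measurable_funTS.
by apply: eq_measure_integral => //= E mE _; exact: lebesgue_measure_scale.
Qed.

Lemma integral_itv0 (f : R -> \bar R) :
  measurable_fun setT f -> (forall t, 0 <= f t)%E ->
  (\int[mu]_t f t =
   \int[mu]_(t in `]-oo, 0%R]) f t + \int[mu]_(t in `]0%R, +oo[) f t)%E.
Proof.
move=> mf f0.
have TE : [set: R] = `]-oo, 0%R]%classic `|` `]0%R, +oo[%classic.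
  by apply/seteqP; split => t //= _; rewrite !in_itv/= andbT; case: (leP t 0); [left|right].
rewrite [in LHS]TE ge0_integral_setU//; first by rewrite -TE.
apply/disj_setPS => t /= [].
by rewrite !in_itv/= andbT => /le_lt_trans h /h; rewrite ltxx.
Qed.

Lemma integral_even (f : R -> \bar R) :
  measurable_fun setT f -> (forall t, 0 <= f t)%E ->
  (forall t, f (- t)%R = f t) ->
  (\int[mu]_(t in `]-oo, 0%R]) f t = \int[mu]_(t in `]0%R, +oo[) f t)%E.
Proof.
move=> mf f0 fN; rewrite integral_itv_obnd_cbnd; last exact: measurable_funTS.
by rewrite ge0_integration_by_substitution0//; apply: eq_integral => t _; rewrite fN.
Qed.

Lemma measurable_stretch (A B : R) : measurable_fun setT (stretch A B).
Proof.
apply: measurable_fun_ifT.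
- exact: measurable_fun_ltr.
- exact: mulrr_measurable.
- exact: mulrr_measurable.
Qed.

(** Each half-line is scaled by its own factor, and by evenness carries half of the integral of
    [f (t ^+ 2)]. *)
Lemma integral_stretch (A B : R) (f : R -> \bar R) :
  0 < A -> 0 < B -> measurable_fun setT f -> (forall t, 0 <= f t)%E ->
  (\int[mu]_t f (stretch A B t ^+ 2)%R =
   ((A + B) / 2)%:E * \int[mu]_t f (t ^+ 2)%R)%E.
Proof.
move=> A0 B0 mf f0.
have mg : measurable_fun setT (fun t : R => f (t ^+ 2)).
  apply: measurableT_comp => //; exact: exprn_measurable.
have mh : measurable_fun setT (fun t => f (stretch A B t ^+ 2)).
  apply: (@measurableT_comp _ _ _ _ _ _ (fun t : R => f (t ^+ 2))) => //.
  exact: measurable_stretch.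
rewrite !integral_itv0//.
rewrite (eq_integral (fun t : measurableTypeR R => f (((t : R) / B) ^+ 2))); last first.
  by move=> t; rewrite inE/= in_itv/= /stretch => t0; rewrite ltNge t0.
rewrite (@integral_scale B `]-oo, 0%R]%classic (fun t : R => f (t ^+ 2)))//; last first.
  by move=> t; rewrite /= !in_itv/= pmulr_lle0 ?invr_gt0.
rewrite [X in (_ + X = _)%E](eq_integral
  (fun t : measurableTypeR R => f (((t : R) / A) ^+ 2))); last first.
  by move=> t; rewrite inE/= in_itv/= andbT /stretch => ->.
rewrite (@integral_scale A `]0%R, +oo[%classic (fun t : R => f (t ^+ 2)))//; last first.
  by move=> t; rewrite /= !in_itv/= !andbT pmulr_lgt0 ?invr_gt0.
rewrite integral_even//; last by move=> t; rewrite sqrrN.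
set h := (\int[mu]_(t in `]0%R, +oo[) f (t ^+ 2)%R)%E.
have h0 : (0 <= h)%E by apply: integral_ge0.
have -> : (h + h = 2%:E * h)%E by rewrite -[X in (X + X)%E]mul1e -ge0_muleDl.
rewrite muleA -ge0_muleDl ?lee_fin ?ltW//.
by congr (_ * _)%E; rewrite -EFinD -EFinM; congr _%:E; field.
Qed.

Definition bvol n (s : R) := wvol (fun t : R => t ^+ 2) n s.

(* By the symmetry of the ball, stretching the positive half-lines by [A] and
   the negative ones by [B] multiplies its volume by the sum over the orthants
   of [A^k B^(n-k) / 2^n]. *)
Lemma wvol_stretch (A B s : R) n : 0 < A -> 0 < B ->
  wvol (fun t => stretch A B t ^+ 2) n s =
  ((((A + B) / 2) ^+ n)%:E * bvol n s)%E.
Proof.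
move=> A0 B0; elim: n s => [|n IH] s; first by rewrite /bvol !wvol0 expr0 mul1e.
have AB0 : (0 <= (A + B) / 2) by rewrite divr_ge0// addr_ge0// ltW.
have mW : measurable_fun setT (fun t : R => bvol n (s - t)).
  exact: measurable_wvolB.
rewrite /bvol !wvolS -/bvol; under eq_integral do rewrite IH.
rewrite ge0_integralZl//=; last 3 first.
- apply: (@measurableT_comp _ _ _ _ _ _ (fun t : R => bvol n (s - t))) => //.
  apply: (@measurableT_comp _ _ _ _ _ _ (fun t : R => t ^+ 2)).
    exact: exprn_measurable.
  exact: measurable_stretch.
- by move=> t _; exact: vol_ge0.
- by rewrite lee_fin exprn_ge0.
rewrite (@integral_stretch A B (fun t : R => bvol n (s - t)))//.
  by rewrite muleA -EFinM -exprSr.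
by move=> t; exact: vol_ge0.
Qed.

End IteratedVolume.

(** * Euclidean balls *)

Section Ball.
Variable R : realType.
Local Notation mu := (@lebesgue_measure R).

Lemma wsum_sqr n (x : 'rV[R]_n) : wsum (fun t => t ^+ 2) x = dotv x x.
Proof. by apply: eq_bigr => i _; rewrite expr2. Qed.

Lemma wsum_sqr_ge0 n (x : 'rV[R]_n) : 0 <= wsum (fun t => t ^+ 2) x.
Proof. by apply: sumr_ge0 => i _; exact: sqr_ge0. Qed.

Lemma bvol_lt0 n (s : R) : s < 0 -> bvol n s = 0%E.
Proof.
move=> s0; rewrite /bvol /wvol (_ : [set x | _] = set0).
  elim: n => [|n IH]; first by rewrite (vol0 _ 0) indic0.
  by rewrite volS -[RHS](integral0 mu setT); apply: eq_integral.
apply/seteqP; split => // x /= xs.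
by have := wsum_sqr_ge0 x; rewrite leNgt (le_lt_trans xs s0).
Qed.

Lemma integral_cst_indic (c : \bar R) (a b : R) : (0 <= c)%E -> a <= b ->
  (\int[mu]_t (c * (\1_(`[a, b]%classic : set R) t)%:E) = c * (b - a)%:E)%E.
Proof.
move=> c0 ab; rewrite ge0_integralZl//.
  rewrite integral_indic//= setIT lebesgue_measure_itv/= lte_fin.
  by case: ltgtP ab => // -> _; rewrite subrr.
by apply/measurable_EFinP; exact: measurable_indic.
Qed.

(** For [s >= 0], slices at [|t| > s + 1] have negative level, and the others have volume at most
    [bvol n s]. *)
Lemma bvol_fin n (s : R) : (bvol n s < +oo)%E.
Proof.
elim: n s => [|n IH] s; first by rewrite /bvol wvol0 ltry.
have [s0|s0] := ltP s 0; first by rewrite bvol_lt0.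
rewrite /bvol wvolS -/(bvol _ _).
apply: (@le_lt_trans _ _ (\int[mu]_t (bvol n s * (\1_(`[-(s + 1), s + 1]%classic : set R) t)%:E))%E).
  apply: ge0_le_integral_nomeas => t; first exact: vol_ge0.
  have [ts|ts] := lerP `|t| (s + 1).
    rewrite indicE mem_set ?mule1; last by rewrite /= in_itv/= -ler_norml.
    by apply: wvol_homo; rewrite gerBl sqr_ge0.
  have h : s - t ^+ 2 < 0.
    rewrite subr_lt0 -(real_normK (num_real t)); nra.
  by rewrite -/(bvol _ _) bvol_lt0// mule_ge0 ?vol_ge0// lee_fin.
rewrite integral_cst_indic ?vol_ge0//; last by lra.
by rewrite lte_mul_pinfty ?vol_ge0// ?ltry// ge0_fin_numE// vol_ge0.
Qed.

Lemma bvol_gt0 n (s : R) : 0 < s -> (0 < bvol n s)%E.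
Proof.
elim: n s => [|n IH] s s0; first by rewrite /bvol wvol0 ltW// lte_fin.
rewrite /bvol wvolS.
pose a := Num.sqrt (s / 2).
have a0 : 0 < a by rewrite sqrtr_gt0 divr_gt0.
apply: (@lt_le_trans _ _ (\int[mu]_t (bvol n (s/2) * (\1_(`[-a, a]%classic : set R) t)%:E))%E).
  rewrite integral_cst_indic ?vol_ge0//; last by lra.
  by rewrite mule_gt0 ?IH ?divr_gt0// lte_fin; lra.
apply: ge0_le_integral_nomeas => t; first by rewrite mule_ge0 ?vol_ge0// lee_fin.
rewrite indicE; case: (boolP (_ \in _)) => [|_]; last by rewrite mule0 vol_ge0.
rewrite inE/= in_itv/= -ler_norml mule1 => ta; apply: wvol_homo.
have : t ^+ 2 <= a ^+ 2 by rewrite -(real_normK (num_real t)) lerXn2r// ?nnegrE ?ltW.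
rewrite /a sqr_sqrtr; first by lra.
by rewrite divr_ge0 ?ltW.
Qed.

Lemma unit_eballE n : @unit_eball R n = [set x | wsum (fun t => t ^+ 2) x <= 1].
Proof.
apply/funext => x /=; rewrite /unit_eball/= /enorm wsum_sqr; apply/propext.
by rewrite -{1}sqrtr1 ler_sqrt.
Qed.

Lemma vol_unit_eball n : vol (@unit_eball R n) = bvol n 1.
Proof. by rewrite unit_eballE. Qed.

Lemma vol_scale_eball n (r : R) : 0 < r ->
  vol (scale_set r (@unit_eball R n)) = ((r ^+ n)%:E * bvol n 1)%E.
Proof.
move=> r0.
have -> : r ^+ n = ((r + r) / 2) ^+ n by congr (_ ^+ _); field.
rewrite -wvol_stretch// /wvol; congr vol; rewrite unit_eballE.
have E t : stretch r r t = t / r by rewrite /stretch; case: ifP.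
apply/seteqP; split => [_ /= [x x1 <-]|x /= x1].
  rewrite (_ : wsum _ _ = wsum (fun t => t ^+ 2) x)//.
  by apply: eq_bigr => i _; rewrite E mxE mulrC mulKf ?gt_eqF.
exists (r^-1 *: x); last by rewrite scalerA divff ?gt_eqF// scale1r.
rewrite /= (_ : wsum _ _ = wsum (fun t => stretch r r t ^+ 2) x)//.
by apply: eq_bigr => i _; rewrite E mxE mulrC.
Qed.

(** The set lies in the ball of any radius [d > 0], whose volume is at most [d] times that of the
    unit ball when [d <= 1]. *)
Lemma vol_scale_eball0 n : (0 < n)%N ->
  vol (scale_set 0 (@unit_eball R n)) = 0%E.
Proof.
move=> n0; apply/eqP; rewrite eq_le vol_ge0 andbT.
apply/lee_addgt0Pr => e e0; rewrite add0e.
have := @bvol_fin n 1; have := @bvol_gt0 n 1 ltr01.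
case: (bvol n 1) (vol_scale_eball n) => // b sc; rewrite lte_fin => b0 _.
pose d := Num.min 1 (e / b).
have d0 : 0 < d by rewrite lt_min ltr01 divr_gt0.
apply: (@le_trans _ _ (vol (scale_set d (@unit_eball R n)))).
  apply: vol_le => _ [x x1 <-]; exists 0; last by rewrite scaler0 scale0r.
  by rewrite unit_eballE/= /wsum big1 // => i _; rewrite mxE expr0n.
rewrite sc// -EFinM lee_fin -ler_pdivlMr//.
apply: (@le_trans _ _ d); last by rewrite /d ge_min lexx orbT.
have d1 : d ^+ n.-1 <= 1.
  by apply: exprn_ile1; [exact: ltW|rewrite /d ge_min lexx].
by rewrite -[X in _ ^+ X](prednK n0) exprS ler_piMr// ltW.
Qed.

Lemma effective_radius_exists n (K : set 'rV[R]_n) : (0 < n)%N ->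
  (vol K < +oo)%E -> exists2 r : R, effective_radius K r &
    ((r ^+ n)%:E * bvol n 1 = vol K)%E.
Proof.
move=> n0 Kfin; have := @bvol_fin n 1; have := @bvol_gt0 n 1 ltr01.
have := vol_ge0 K; rewrite /effective_radius.
case: (vol K) Kfin => // v _; rewrite lee_fin => v0.
case: (bvol n 1) (@vol_scale_eball n) => // b sc; rewrite lte_fin => b0 _.
have [v00|vn0] := eqVneq v 0.
  exists 0; first by rewrite vol_scale_eball0// v00.
  by rewrite expr0n eqn0Ngt n0/= v00 mul0e.
have vb0 : 0 < v / b by rewrite divr_gt0// lt_neqAle eq_sym vn0.
pose r := (v / b) `^ (n%:R^-1).
have r0 : 0 < r by rewrite powR_gt0.
have rn : r ^+ n = v / b.
  rewrite -powR_mulrn ?ltW// -powRrM mulVf ?powRr1 ?ltW//.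
  by rewrite pnatr_eq0 -lt0n.
have E : ((r ^+ n)%:E * b%:E = v%:E)%E by rewrite rn -EFinM divfK// gt_eqF.
by exists r => //; split; [exact: ltW|rewrite sc// E].
Qed.

End Ball.

(** * Chords parallel to the last axis *)

Section AxialSlices.
Variable R : realType.
Local Notation mu := (@lebesgue_measure R).

Definition off_axis m (x : 'rV[R]_m.+1) : R :=
  dotv x x - x ord0 ord_max ^+ 2.

(** The axis is the last coordinate because [volS] removes the first; [s] accumulates the squares of
    the removed coordinates. *)
Definition axial_vol (I : R -> set R) m (s : R) :=
  vol [set x : 'rV[R]_m.+1 | I (s + off_axis x) (x ord0 ord_max)].

Lemma axial_vol0 I (s : R) : measurable (I s) -> axial_vol I 0 s = mu (I s).
Proof.
move=> mI; rewrite /axial_vol volS.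
rewrite (eq_integral (fun t : measurableTypeR R => (\1_(I s) t)%:E)).
  by rewrite integral_indic//= setIT.
move=> t _; rewrite (vol0 _ 0) !indicE; congr (_%:R)%:E; congr nat_of_bool.
have oE (x : 'rV[R]_1) : off_axis x = 0.
  by rewrite /off_axis /dotv big_ord1 (ord1 ord_max) -expr2 subrr.
by apply/idP/idP; rewrite !inE/= oE addr0 (ord1 ord_max) row_cons0.
Qed.

Lemma off_axisS m t (x : 'rV[R]_m.+1) :
  off_axis (row_cons t x) = t ^+ 2 + off_axis x.
Proof.
rewrite /off_axis -!wsum_sqr wsumS (_ : ord_max = lift ord0 ord_max); last exact/val_inj.
by rewrite row_consS addrA.
Qed.

Lemma axial_volS I m (s : R) :
  axial_vol I m.+1 s = (\int[mu]_t axial_vol I m (s + t ^+ 2)%R)%E.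
Proof.
rewrite /axial_vol volS; apply: eq_integral => t _; congr vol.
apply/funext => x /=; rewrite off_axisS addrA (_ : ord_max = lift ord0 ord_max); last exact/val_inj.
by rewrite row_consS.
Qed.

Section Comparison.
Variables I J : R -> set R.
Hypothesis I_antitone : forall s t, s <= t -> I t `<=` I s.
Hypothesis J_antitone : forall s t, s <= t -> J t `<=` J s.
Hypothesis mI : forall s, measurable (I s).
Hypothesis mJ : forall s, measurable (J s).
Hypothesis leIJ : forall s, 0 <= s -> (mu (I s) <= mu (J s))%E.
Hypothesis ltIJ : forall s, 0 < s < 1 -> (mu (I s) < mu (J s))%E.
Hypothesis J_fin : forall m s, 0 <= s -> (axial_vol J m s < +oo)%E.

Lemma axial_vol_le m s : 0 <= s -> (axial_vol I m s <= axial_vol J m s)%E.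
Proof.
elim: m s => [|m IH] s s0; first by rewrite !axial_vol0// leIJ.
rewrite !axial_volS; apply: ge0_le_integral_nomeas => t; first exact: vol_ge0.
by apply: IH; rewrite addr_ge0// sqr_ge0.
Qed.

Lemma measurable_axial_vol (K : R -> set R) m s :
  (forall s t, s <= t -> K t `<=` K s) ->
  measurable_fun setT (fun t : R => axial_vol K m (s + t ^+ 2)).
Proof.
move=> K_anti; apply: (@measurableT_comp _ _ _ _ _ _ (fun u => axial_vol K m (s + u))).
  apply: eantitone_measurable => x y xy; apply: vol_le => z /=.
  by apply: K_anti; rewrite lerD2r lerD2l.
exact: exprn_measurable.
Qed.

Lemma axial_volS_lt m s :
  (forall s, 0 < s < 1 -> (axial_vol I m s < axial_vol J m s)%E) ->
  0 <= s < 1 -> (axial_vol I m.+1 s < axial_vol J m.+1 s)%E.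
Proof.
move=> IH /andP[s0 s1]; rewrite !axial_volS.
have st0 (t : R) : 0 <= s + t ^+ 2 by rewrite addr_ge0// sqr_ge0.
(* For [0 < t < 1 - s] one has [t^2 < t], hence [0 < s + t^2 < 1], where the slices compare
   strictly. *)
apply: (@ge0_lt_integral _ _ R mu `]0, 1 - s[%classic) => //.
- exact: measurable_axial_vol.
- exact: measurable_axial_vol.
- by move=> t; exact: vol_ge0.
- by move=> t; apply: le_lt_trans (J_fin m (st0 t)); exact: axial_vol_le.
- by move=> t; exact: axial_vol_le.
- by rewrite /= lebesgue_measure_itv/= lte_fin subr_gt0 s1 -EFinB lte_fin; lra.
- move=> t; rewrite /= in_itv/= => /andP[t0 ts]; apply: IH.
  apply/andP; split; nra.
- by have := J_fin m.+1 s0; rewrite axial_volS.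
Qed.

(** Chords on the axis ([s = 0]) may have equal length, as they do for the Reuleaux body and the
    ball; strictness at 0 comes from one integration, hence [m.+1]. *)
Lemma axial_vol_lt m : (axial_vol I m.+1 0 < axial_vol J m.+1 0)%E.
Proof.
suff H s : 0 < s < 1 -> (axial_vol I m s < axial_vol J m s)%E.
  by apply: axial_volS_lt => //; rewrite lexx ltr01.
elim: m s => [|m IH] s /andP[s0 s1]; first by rewrite !axial_vol0// ltIJ// s0.
by apply: axial_volS_lt => //; rewrite ltW.
Qed.

End Comparison.

(* The heights, at squared distance [s] from the axis, of the points within
   distance 2 of the apex, which is at height [sqrt 3], and of the farthest
   point of the unit sphere at height 0.  Negative arguments of the square
   roots do no harm: the interval is empty for [s > 1]. *)
Definition reuleaux_chord (s : R) : set R :=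
  `[Num.sqrt 3 - Num.sqrt (4 - s),
    Num.sqrt (4 - (1 + Num.sqrt s) ^+ 2)]%classic.

Definition ball_chord (s : R) : set R := [set t | t ^+ 2 <= 1 - s].

Lemma ball_chordE s : s <= 1 ->
  ball_chord s = `[- Num.sqrt (1 - s), Num.sqrt (1 - s)]%classic.
Proof.
move=> s1; apply/seteqP; split => t; rewrite /ball_chord/= in_itv/= -ler_norml.
  by rewrite -sqrtr_sqr => h; rewrite ler_wsqrtr.
move=> h; rewrite -(@sqr_sqrtr _ (1 - s)) ?subr_ge0//.
by rewrite -(real_normK (num_real t)) lerXn2r// ?nnegrE ?sqrtr_ge0.
Qed.

Lemma reuleaux_chord_antitone s t : s <= t ->
  reuleaux_chord t `<=` reuleaux_chord s.
Proof.
move=> st x; rewrite /reuleaux_chord/= !in_itv/= => /andP[h1 h2].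
apply/andP; split.
  apply: le_trans h1; rewrite lerD2l lerN2 ler_wsqrtr//; lra.
apply: (le_trans h2); rewrite ler_wsqrtr// lerD2l lerN2.
have := ler_wsqrtr st; have := sqrtr_ge0 s; have := sqrtr_ge0 t; nra.
Qed.

Lemma reuleaux_chord_eq0 s : 0 <= s -> 1 < s -> reuleaux_chord s = set0.
Proof.
move=> s0 s1; apply/seteqP; split => // t; rewrite /reuleaux_chord/= in_itv/=.
have q1 : 1 < Num.sqrt s by rewrite -sqrtr1 ltr_sqrt// (lt_trans ltr01).
(* The radicand is negative, so the upper end is 0, while the lower end is positive. *)
rewrite (@ler0_sqrtr _ (4 - (1 + Num.sqrt s) ^+ 2)); last by nra.
have : Num.sqrt (4 - s) < Num.sqrt 3 by rewrite ltr_sqrt//; lra.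
move=> h /andP[h1 h2]; lra.
Qed.

(* With [u = sqrt s], [a = sqrt (4 - (1 + u)^2)] and [c = sqrt (4 - u^2)], the
   defect [d] is [2 (sqrt 3 - a) (c - sqrt 3) + 2 u (1 - u)]. *)
Lemma reuleaux_chord_length (s : R) : 0 <= s <= 1 ->
  exists2 d, 0 <= d /\ (0 < s < 1 -> 0 < d) &
  (Num.sqrt (4 - (1 + Num.sqrt s) ^+ 2)
     - (Num.sqrt 3 - Num.sqrt (4 - s))) ^+ 2 + d =
    (2 * Num.sqrt (1 - s)) ^+ 2.
Proof.
move=> /andP[s0 s1].
have u0 := sqrtr_ge0 s; have su := sqr_sqrtr s0.
have u1 : Num.sqrt s <= 1 by rewrite -sqrtr1 ler_wsqrtr.
have ust : 0 < s < 1 -> 0 < Num.sqrt s < 1.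
  by move=> /andP[s0' s1']; rewrite sqrtr_gt0 s0' -[ltRHS]sqrtr1 ltr_sqrt.
have q2 : Num.sqrt 3 ^+ 2 = 3 :> R by rewrite sqr_sqrtr.
have bq : Num.sqrt 3 <= Num.sqrt (4 - s) by rewrite ler_wsqrtr//; lra.
have aq : Num.sqrt (4 - (1 + Num.sqrt s) ^+ 2) <= Num.sqrt 3.
  by rewrite ler_wsqrtr//; nra.
have c2 : Num.sqrt (4 - s) ^+ 2 = 4 - s by rewrite sqr_sqrtr//; lra.
have a2 : Num.sqrt (4 - (1 + Num.sqrt s) ^+ 2) ^+ 2 = 4 - (1 + Num.sqrt s) ^+ 2.
  by rewrite sqr_sqrtr//; nra.
have r2 : Num.sqrt (1 - s) ^+ 2 = 1 - s by rewrite sqr_sqrtr//; lra.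
move: (Num.sqrt (4 - (1 + Num.sqrt s) ^+ 2)) aq a2 => a aq a2.
move: (Num.sqrt (4 - s)) bq c2 => c bq c2.
move: (Num.sqrt (1 - s)) r2 => r r2.
move: (Num.sqrt s) u0 su u1 ust a2 => u u0 su u1 ust a2.
move: (Num.sqrt 3) q2 aq bq => q q2 aq bq.
exists (2 * (q - a) * (c - q) + 2 * u * (1 - u)).
  split=> [|/ust /andP[u0' u1']].
    by rewrite addr_ge0// !mulr_ge0// subr_ge0.
  by rewrite ltr_wpDl// ?mulr_ge0 ?subr_ge0// !mulr_gt0// subr_gt0.
rewrite exprMn r2 -su; nra.
Qed.

Lemma reuleaux_chord_le s : 0 <= s ->
  (mu (reuleaux_chord s) <= mu (ball_chord s))%E /\
  (s < 1 -> 0 < s -> (mu (reuleaux_chord s) < mu (ball_chord s))%E).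
Proof.
move=> s0; have [s1|s1] := leP s 1; last first.
  rewrite reuleaux_chord_eq0// measure0; split; first exact: measure_ge0.
  by move=> /(lt_trans s1); rewrite ltxx.
have [|d [d0 dpos] dE] := @reuleaux_chord_length s; first by rewrite s0.
rewrite ball_chordE// /reuleaux_chord !lebesgue_measure_itv/= !lte_fin.
move: dE; set a := Num.sqrt (4 - _); set b := (Num.sqrt 3 - _).
set r := Num.sqrt (1 - s) => dE.
have r0 : 0 <= r by exact: sqrtr_ge0.
have rpos : s < 1 -> 0 < r by rewrite sqrtr_gt0 subr_gt0.
split.
  case: ifPn => ba; case: ifPn => rr; rewrite -?EFinB ?lee_fin//; try nra.
move=> s1' s0'; have {}dpos := dpos (introT andP (conj s0' s1')).
have {}rpos := rpos s1'.
rewrite [X in (_ < (if X then _ else _))%E](_ : _ = true); last by lra.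
by case: ifPn => ba; rewrite -?EFinB ?lte_fin//; nra.
Qed.

Lemma axial_vol_ball m s : axial_vol ball_chord m s = bvol m.+1 (1 - s).
Proof.
rewrite /axial_vol /bvol /wvol; congr vol; apply/funext => x.
by rewrite /ball_chord/= /off_axis wsum_sqr; apply/propext; split; lra.
Qed.

Lemma axial_vol_reuleaux_lt m :
  (axial_vol reuleaux_chord m.+1 0 < vol (@unit_eball R m.+2))%E.
Proof.
rewrite vol_unit_eball -[1 in ltRHS]subr0 -axial_vol_ball.
apply: axial_vol_lt.
- exact: reuleaux_chord_antitone.
- by move=> s t st x; rewrite /ball_chord/= => /le_trans; apply; rewrite lerD2l lerN2.
- by move=> s; exact: measurable_itv.
- move=> s; have [s1|s1] := leP s 1; first by rewrite ball_chordE//; exact: measurable_itv.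
  rewrite (_ : ball_chord s = set0)//; apply/seteqP; split => // t; rewrite /ball_chord/=.
  have := sqr_ge0 t; lra.
- by move=> s s0; case: (reuleaux_chord_le s0).
- by move=> s /andP[s0 s1]; case: (reuleaux_chord_le (ltW s0)) => _; apply.
- by move=> k s _; rewrite axial_vol_ball bvol_fin.
Qed.

End AxialSlices.

(** * Complete sets of diameter 2 *)

Section Dot.
Variables (R : realType) (n : nat).
Implicit Types x y z u v : 'rV[R]_n.

Lemma dotvC x y : dotv x y = dotv y x.
Proof. by apply: eq_bigr => i _; rewrite mulrC. Qed.

Lemma dotvDl x y z : dotv (x + y) z = dotv x z + dotv y z.
Proof. by rewrite /dotv -big_split; apply: eq_bigr => i _; rewrite mxE mulrDl. Qed.

Lemma dotvDr x y z : dotv z (x + y) = dotv z x + dotv z y.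
Proof. by rewrite dotvC dotvDl !(dotvC _ z). Qed.

Lemma dotvZl a x z : dotv (a *: x) z = a * dotv x z.
Proof. by rewrite /dotv mulr_sumr; apply: eq_bigr => i _; rewrite mxE mulrA. Qed.

Lemma dotvZr a x z : dotv z (a *: x) = a * dotv z x.
Proof. by rewrite dotvC dotvZl dotvC. Qed.

Lemma dotvNl x z : dotv (- x) z = - dotv x z.
Proof. by rewrite -scaleN1r dotvZl mulN1r. Qed.

Lemma dotvNr x z : dotv z (- x) = - dotv z x.
Proof. by rewrite dotvC dotvNl dotvC. Qed.

Definition dotvE := (dotvDl, dotvDr, dotvZl, dotvZr, dotvNl, dotvNr).

Lemma dotv_delta x i : dotv x (delta_mx ord0 i) = x ord0 i.
Proof.
rewrite /dotv (bigD1 i)//= big1 ?addr0 ?mxE ?eqxx ?mulr1// => j.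
by move=> /negbTE ji; rewrite mxE ji andbF mulr0.
Qed.

Lemma dotv_ge0 x : 0 <= dotv x x.
Proof. by apply: sumr_ge0 => i _; rewrite -expr2 sqr_ge0. Qed.

(** Squared distances keep the estimates polynomial; distance 2 reads as 4. *)
Definition sqdist x y := dotv (x - y) (x - y).

Lemma sqdistC x y : sqdist x y = sqdist y x.
Proof. by rewrite /sqdist -(opprB y x) dotvNl dotvNr opprK. Qed.

Lemma sqdistxx x : sqdist x x = 0.
Proof. by rewrite /sqdist subrr -(scale0r x) dotvZl mul0r. Qed.

Lemma enorm1_dotv u : enorm u = 1 -> dotv u u = 1.
Proof. by move=> u1; rewrite -[LHS]sqr_sqrtr ?dotv_ge0// -/(enorm u) u1 expr1n. Qed.

Lemma sqdist_continuous y : continuous (sqdist ^~ y).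
Proof.
rewrite /sqdist /dotv; apply: continuous_big => [|i _ x]; first exact: add_continuous.
have h : {for x, continuous (fun z : 'rV[R]_n => (z - y) ord0 i)}.
  rewrite (_ : (fun z => _) = (fun z : 'rV[R]_n => z ord0 i - y ord0 i)).
    by apply: continuousB; [exact: coord_continuous|exact: cst_continuous].
  by apply/funext => z; rewrite !mxE.
exact: continuousM.
Qed.

(** A crude bridge from the sup norm to the Euclidean metric, from [|a| <= 1 + a^2]; it serves for
    boundedness. *)
Lemma norm_le_sqdist x y : `|x - y| <= 1 + sqdist x y.
Proof.
have d0 : 0 <= sqdist x y by exact: dotv_ge0.
rewrite [leLHS]/Num.Def.normr/= mx_normrE; apply: bigmax_le; first by lra.
move=> [i j] _ /=; rewrite (ord1 i).
have : (x - y) ord0 j ^+ 2 <= sqdist x y.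
  rewrite /sqdist /dotv (bigD1 j)//= -expr2 lerDl; apply: sumr_ge0 => k _.
  by rewrite -expr2 sqr_ge0.
by rewrite -(real_normK (num_real _)); nra.
Qed.

End Dot.

Section Complete.
Variables (R : realType) (n : nat).
Implicit Types (K L : set 'rV[R]_n) (x y z u : 'rV[R]_n).

Definition diam_le2 K := forall x y, K x -> K y -> sqdist x y <= 4.

Definition complete2 K := forall y, (forall x, K x -> sqdist y x <= 4) -> K y.

Lemma complete2_exists L : diam_le2 L ->
  exists K, [/\ L `<=` K, diam_le2 K & complete2 K].
Proof.
move=> dL.
(* Zorn's lemma is applied to the sets [A] to be added to [L], so that the empty chain, with empty
   union, is also covered. *)
have chain (F : set (set 'rV[R]_n)) : F `<=` [set A | diam_le2 (L `|` A)] ->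
    total_on F subset -> [set A | diam_le2 (L `|` A)] (\bigcup_(X in F) X).
  move=> FP Ftot x y /= [Lx|[A FA Ax]] [Ly|[B FB By]].
  - exact: dL.
  - by apply: (FP _ FB x y); [left|right].
  - by apply: (FP _ FA x y); [right|left].
  - case: (Ftot _ _ FA FB) => AB.
      by apply: (FP _ FB x y); right => //; apply: AB.
    by apply: (FP _ FA x y); right => //; apply: AB.
have [A [dA maxA]] := Zorn_bigcup chain.
exists (L `|` A); split => // y yLA.
apply: contrapT => nLAy; apply: (maxA (A `|` [set y])).
  rewrite properEneq; split; last by move=> x; left.
  by apply/eqP => AE; apply: nLAy; right; rewrite AE; right.
move=> x z /= [Lx|[Ax|->]] [Lz|[Az|->]].
- exact: dL.
- by apply: dA; [left|right].
- by rewrite sqdistC; apply: yLA; left.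
- by apply: dA; [right|left].
- by apply: dA; [right|right].
- by rewrite sqdistC; apply: yLA; right.
- by apply: yLA; left.
- by apply: yLA; right.
- by rewrite sqdistxx.
Qed.

Variable K : set 'rV[R]_n.
Hypotheses (dK : diam_le2 K) (cK : complete2 K).

(** This gives width at least 2 in every direction: a support point has an opposite point of [K] at
    distance exactly 2. *)
Lemma complete2_opposite y u : dotv u u = 1 -> K y ->
  (forall x, K x -> dotv x u <= dotv y u) -> K (y - 2 *: u).
Proof.
move=> u1 Ky ymax; apply: cK => w Kw; rewrite leNgt; apply/negP => far.
have [v wE] : exists v, w = y + v by exists (w - y); rewrite addrC subrK.
have vu0 : dotv v u <= 0 by have := ymax _ Kw; rewrite wE dotvDl gerDl.
have {}far : 0 < dotv v v + 4 * dotv v u.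
  move: far; rewrite /sqdist (_ : y - 2 *: u - w = - (v + 2 *: u)); last first.
    by rewrite wE; apply/rowP => i; rewrite !mxE; ring.
  by rewrite !dotvE u1 (dotvC u v); lra.
(* If [K] had a point [w] at distance more than 2 from [y - 2 u], the point
   [y + s (v + t u)] with [v = w - y] and small [s] would still be in [K], and
   higher than [y] in the direction [u] as soon as [t > - v.u]. *)
have [V VE] : exists V, dotv v v = V by eexists.
have [b bE] : exists b, dotv v u = b by eexists.
rewrite VE bE in far; rewrite bE in vu0.
have V0 : 0 < V by lra.
(* The midpoint of [-b] and [V / 4]: thus [b + t > 0] and [V - 4 * t > 0]. The value of [s] ensures
   [s <= 1] and [s * dotv q q <= V - 4 * t]. *)
pose t := (V / 4 - b) / 2.
pose q := v + t *: u.
pose s := (V - 4 * t) / (dotv q q + V).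
have q0 := dotv_ge0 q.
have s0 : 0 < s by rewrite divr_gt0 /t; lra.
have sQ : s * (dotv q q + V) = V - 4 * t by rewrite divfK// gt_eqF//; lra.
have t0 : 0 <= t by rewrite /t; lra.
have s1 : s <= 1.
  rewrite /s ler_pdivrMr ?mul1r; last by lra.
  by move: (dotv q q) q0 => Q q0; lra.
have Kp : K (y + s *: q).
  apply: cK => x Kx.
  have := dK Kx Ky; have := dK Kx Kw; have := dotv_ge0 (x - y + 2 *: u).
  rewrite /sqdist wE.
  rewrite (_ : x - (y + v) = (x - y) - v); last by rewrite opprD addrA.
  rewrite (_ : y + s *: q - x = - ((x - y) - s *: q)); last first.
    by apply/rowP => i; rewrite !mxE; ring.
  move: (x - y) => X.
  have -> : dotv (- (X - s *: q)) (- (X - s *: q)) =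
     dotv X X - 2 * s * (dotv X v + t * dotv X u) + s * (s * dotv q q).
    by rewrite /q !dotvE (dotvC v X) (dotvC u X); ring.
  move: (dotv q q) q0 s s0 sQ s1 => Q q0 s s0 sQ s1; clearbody t.
  rewrite !dotvE (dotvC v X) (dotvC u X) u1 VE.
  move: (dotv X X) (dotv X v) (dotv X u) => XX Xv Xu h1 h2 h3.
  (* [k1] and [k2] average the bounds at [w] and [y] with weights [s] and [1 - s]; [k3] uses
     [(x - y).u >= -2]; [k4] absorbs the rest. *)
  have k1 : 0 <= s * (4 - (XX - 2 * Xv + V)) by apply: mulr_ge0; lra.
  have k2 : 0 <= (1 - s) * (4 - XX) by apply: mulr_ge0; lra.
  have k3 : 0 <= s * (t * (Xu + 2)).
    by apply: mulr_ge0; [lra|apply: mulr_ge0; lra].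
  have k4 : 0 <= s * (V - 4 * t - s * Q) by apply: mulr_ge0; nra.
  lra.
have := ymax _ Kp.
rewrite dotvDl gerDl dotvZl pmulr_rle0// /q !dotvE u1 bE /t; lra.
Qed.

Lemma complete2_closed : closed K.
Proof.
have -> : K = \bigcap_(x in K) [set y | sqdist y x <= 4].
  apply/seteqP; split => [y Ky x Kx|y Ky]; first exact: dK.
  by apply: cK => x Kx; exact: Ky.
apply: closed_bigI => x _.
apply: (@preimage_closed _ _ (fun y => sqdist y x) [set r : R | r <= 4]).
  by move=> y _; exact: sqdist_continuous.
exact: closed_le.
Qed.

Lemma complete2_compact : compact K.
Proof.
have [->|/set0P[x0 Kx0]] := eqVneq K set0; first exact: compact0.
apply: bounded_closed_compact; last exact: complete2_closed.
exists (`|x0| + 5); split; first exact: num_real.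
move=> M hM x Kx; apply: le_trans (ltW hM).
rewrite -[x](subrK x0) addrC (le_trans (ler_normD _ _))// lerD2l.
by apply: le_trans (norm_le_sqdist _ _) _; have := dK Kx Kx0; lra.
Qed.

Lemma complete2_conv a b t : K a -> K b -> 0 <= t <= 1 ->
  K (t *: a + (1 - t) *: b).
Proof.
move=> Ka Kb /andP[t0 t1]; apply: cK => x Kx.
have := dK Ka Kx; have := dK Kb Kx; rewrite /sqdist.
rewrite (_ : _ + _ - x = t *: (a - x) + (1 - t) *: (b - x)); last first.
  by apply/rowP => i; rewrite !mxE; ring.
move: (a - x) (b - x) => A B hB hA.
have := dotv_ge0 (A - B); rewrite !dotvE (dotvC B A).
move: (dotv A A) (dotv B B) (dotv A B) hA hB => p q r *.
have tt : 0 <= t * (1 - t) by rewrite mulr_ge0// subr_ge0.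
nra.
Qed.

Lemma complete2_convex : convex_set K.
Proof.
move=> x y l; rewrite !inE => Kx Ky.
by apply: complete2_conv => //; rewrite ge0 le1.
Qed.

Lemma complete2_support u : K !=set0 -> exists2 y, K y &
  forall x, K x -> dotv x u <= dotv y u.
Proof.
move=> K0; have [|y] := EVT_max_rV (f := fun x => dotv x u) K0 complete2_compact.
  apply: continuous_subspaceT; apply: continuous_big => [|i _ x]; first exact: add_continuous.
  by apply: continuousM; [exact: coord_continuous|exact: cst_continuous].
by rewrite inE => Ky ymax; exists y => // x Kx; apply: ymax; rewrite inE.
Qed.

(* The midpoint of two points of [K] at distance 2 is at distance at most
   [sqrt 3] from every point of [K]. *)
Lemma complete2_interior : (0 < n)%N -> K !=set0 -> interior K !=set0.
Proof.
move=> n0 K0; pose u : 'rV[R]_n := delta_mx ord0 (Ordinal n0).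
have u1 : dotv u u = 1 by rewrite dotv_delta mxE !eqxx.
have [y Ky ymax] := complete2_support u K0.
have Kz := complete2_opposite u1 Ky ymax.
exists (y - u).
(* With [X] the displacement from [y - u] and [W = w - y + u], [|X - W|^2 <= 5 |X|^2 + (5/4) |W|^2]
   and [|W|^2 <= 3]; the radius makes this at most 4. *)
have : \forall x \near y - u, sqdist x (y - u) < 1 / 20.
  have := @sqdist_continuous _ _ (y - u) (y - u).
  move=> /cvgr_lt; apply; rewrite sqdistxx; lra.
apply: filterS => x xnear; apply: cK => w Kw.
have := dK Kw Ky; have := dK Kw Kz; move: xnear; rewrite /sqdist.
rewrite (_ : w - (y - 2 *: u) = (w - y + u) + u); last first.
  by apply/rowP => i; rewrite !mxE; ring.
rewrite (_ : w - y = (w - y + u) - u); last by rewrite addrK.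
rewrite (_ : x - w = (x - (y - u)) - (w - y + u)); last first.
  by apply/rowP => i; rewrite !mxE; ring.
rewrite subrK; move: (x - (y - u)) (w - y + u) => X W.
have := dotv_ge0 (2 *: X + (1/2) *: W); rewrite !dotvE (dotvC W X) (dotvC u W) u1.
lra.
Qed.

Lemma complete2_constant_width : (0 < n)%N -> K !=set0 -> constant_width 2 K.
Proof.
move=> n0 K0; split.
  split; [exact: complete2_compact|exact: complete2_convex|exact: complete2_interior].
move=> p u /enorm1_dotv u1.
have [y Ky ymax] := complete2_support u K0.
have Kz := complete2_opposite u1 Ky ymax.
pose c := dotv (y - p) u.
rewrite /line_length (_ : [set t | _] = `[c - 2, c]%classic).
  rewrite lebesgue_measure_itv/= lte_fin ifT; last by lra.
  by rewrite -EFinB; congr _%:E; ring.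
apply/seteqP; split => t /=; rewrite in_itv/=.
  move=> [x Kx]; rewrite /line_proj => /addrI /(congr1 (fun z => dotv z u)).
  rewrite !dotvZl u1 !mulr1 => <-.
  have := ymax _ Kx; rewrite /c !dotvE => h; apply/andP; split; last by lra.
  (* Expanding the square replaces Cauchy-Schwarz: [|x - y| <= 2] gives [(x - y).u >= -2]. *)
  have := dK Kx Ky; have := dotv_ge0 (x - y + 2 *: u); rewrite /sqdist.
  have -> : dotv x u = dotv (x - y) u + dotv y u by rewrite !dotvE; ring.
  move: (x - y) => X; rewrite !dotvE (dotvC u X) u1; lra.
move=> /andP[t1 t2]; exists (y - (c - t) *: u); last first.
  rewrite /line_proj; congr (_ + _ *: _).
  by rewrite !dotvE u1 /c !dotvE; ring.
rewrite (_ : _ - _ = (1 - (c - t) / 2) *: y +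
    (1 - (1 - (c - t) / 2)) *: (y - 2 *: u)); last first.
  by apply/rowP => i; rewrite !mxE; field.
by apply: complete2_conv => //; apply/andP; split; lra.
Qed.

End Complete.

(** * High dimension *)

Section HighDimension.
Variable R : realType.
Local Notation mu := (@lebesgue_measure R).

(** Proved slice by slice: the union is only bounded by monotonicity, and additivity of the integral
    is applied to the measurable bounds. *)
Lemma vol_wsum_union (w1 w2 : R -> R) n (s1 s2 : R) :
  measurable_fun setT w1 -> measurable_fun setT w2 ->
  (vol [set x : 'rV[R]_n | wsum w1 x <= s1 \/ wsum w2 x <= s2]%R <=
   wvol w1 n s1 + wvol w2 n s2)%E.
Proof.
move=> mw1 mw2.
have mW (w : R -> R) k s : measurable_fun setT w ->
    measurable_fun setT (fun t : R => wvol w k (s - w t)).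
  move=> mw; apply: (@measurableT_comp _ _ _ _ _ _ (fun t : R => wvol w k (s - t))) => //.
  exact: measurable_wvolB.
elim: n s1 s2 => [|n IH] s1 s2.
  rewrite !wvol0 (vol0 _ 0) indicE -EFinD lee_fin -natrD ler_nat.
  case: (boolP (_ \in _)) => //; rewrite inE /= /wsum !big_ord0.
  by case=> ->; rewrite ?addn1 ?add1n.
rewrite !wvolS -ge0_integralD//.
- rewrite volS; apply: ge0_le_integral_nomeas => t; first exact: vol_ge0.
  apply: le_trans (IH (s1 - w1 t) (s2 - w2 t)); apply: vol_le => x /=.
  by rewrite !wsumS -!lerBrDl.
- by move=> t _; exact: vol_ge0.
- exact: mW.
- by move=> t _; exact: vol_ge0.
- exact: mW.
Qed.

Definition neg_part n (y : 'rV[R]_n) : 'rV[R]_n :=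
  \row_i if 0 < y ord0 i then 0 else - y ord0 i.

(** [pos_sq] and [neg_sq] are the squared norms of the positive and negative parts. *)
Definition pos_sq n (y : 'rV[R]_n) : R :=
  \sum_i if 0 < y ord0 i then y ord0 i ^+ 2 else 0.

Definition neg_sq n (y : 'rV[R]_n) : R :=
  \sum_i if 0 < y ord0 i then 0 else y ord0 i ^+ 2.

Lemma dotv_neg_part n (y : 'rV[R]_n) :
  [/\ dotv (neg_part y) (neg_part y) = neg_sq y,
      dotv y (neg_part y) = - neg_sq y & dotv y y = pos_sq y + neg_sq y].
Proof.
split.
- by apply: eq_bigr => i _; rewrite mxE; case: ifP => _; ring.
- rewrite /neg_sq -sumrN; apply: eq_bigr => i _.
  by rewrite mxE; case: ifP => _; ring.
- rewrite /neg_sq -big_split; apply: eq_bigr => i _ /=.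
  by case: ifP => _; ring.
Qed.

Lemma wsum_stretch n (y : 'rV[R]_n) (A B : R) :
  wsum (fun t => stretch A B t ^+ 2) y = pos_sq y / A ^+ 2 + neg_sq y / B ^+ 2.
Proof.
rewrite /pos_sq /neg_sq !mulr_suml -big_split; apply: eq_bigr => i _ /=.
by rewrite /stretch; case: ifP => _; rewrite mul0r ?addr0 ?add0r expr_div_n.
Qed.

Definition orthant_cap n : set 'rV[R]_n :=
  [set x : 'rV[R]_n | (forall i, 0 <= x ord0 i) /\ dotv x x <= 2].

Lemma orthant_cap_diam n : diam_le2 (@orthant_cap n).
Proof.
move=> x y [x0 x2] [y0 y2].
have xy : 0 <= dotv x y by apply: sumr_ge0 => i _; exact: mulr_ge0.
by rewrite /sqdist !dotvE (dotvC y x); lra.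
Qed.

(* The tests are against points of norm [7/5], slightly less than [sqrt 2]: the
   normalized negative part of [y], or a basis vector along a small coordinate
   when [y] is in the positive orthant. *)
Lemma orthant_cap_hull n (y : 'rV[R]_n) : (2000 <= n)%N ->
  (forall x, orthant_cap x -> sqdist y x <= 4) ->
  wsum (fun t => stretch (3/2) (9/20) t ^+ 2) y <= 1 \/
  wsum (fun t => stretch (5/4) (7/10) t ^+ 2) y <= 1.
Proof.
move=> n2000 hy; have [zz yz yy] := dotv_neg_part y.
have a0 : 0 <= pos_sq y.
  by apply: sumr_ge0 => i _; case: ifP => // _; exact: sqr_ge0.
have b0 : 0 <= neg_sq y by rewrite -zz; exact: dotv_ge0.
rewrite !wsum_stretch.
have [nb|nb] := eqVneq (neg_sq y) 0.
  left; rewrite nb mul0r addr0.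
  have yy4 : dotv y y <= 4.
    have := hy 0; rewrite /sqdist subr0; apply; split.
      by move=> i; rewrite mxE.
    by rewrite /dotv big1// => i _; rewrite mxE mul0r.
  (* Otherwise [|y|^2 >= 2000/256 > 4]. Testing along this coordinate gives
     [|y|^2 <= 4 - 49/25 + 7/40 < (3/2)^2]. *)
  have [i yi] : exists i, y ord0 i <= 1 / 16.
    apply: contrapT => /forallNP H.
    have : \sum_(i < n) (1 / 256 : R) <= dotv y y.
      apply: ler_sum => i _; have /negP := H i; rewrite -ltNge; nra.
    rewrite sumr_const card_ord -mulr_natr.
    have : 2000%:R <= n%:R :> R by rewrite ler_nat.
    lra.
  have := hy ((7/5) *: delta_mx ord0 i).
  rewrite /sqdist !dotvE (dotvC _ y) !dotv_delta mxE !eqxx/= yy nb.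
  have cap : orthant_cap ((7 / 5 : R) *: delta_mx ord0 i : 'rV[R]_n).
    split; last by rewrite !dotvE dotv_delta mxE !eqxx/=; lra.
    by move=> j; rewrite !mxE mulr_ge0// ler0n.
  by move=> /(_ cap); lra.
pose b := Num.sqrt (neg_sq y).
have bpos : 0 < b by rewrite sqrtr_gt0 lt_neqAle eq_sym nb.
have bb : b ^+ 2 = neg_sq y by rewrite sqr_sqrtr.
have := hy ((7 / 5 / b) *: neg_part y).
rewrite /sqdist !dotvE (dotvC _ y) zz yz yy -bb.
have cap : orthant_cap ((7 / 5 / b) *: neg_part y).
  split.
    move=> j; rewrite !mxE; apply: mulr_ge0; first by rewrite divr_ge0// ltW.
    by case: ltP => //; rewrite oppr_ge0.
  rewrite !dotvE zz -bb.
  have -> : 7 / 5 / b * (7 / 5 / b * b ^+ 2) = 49 / 25 by field; rewrite gt_eqF.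
  lra.
move=> /(_ cap).
have -> : pos_sq y + b ^+ 2 + - (7 / 5 / b * - b ^+ 2) +
    (- (7 / 5 / b * - b ^+ 2) + - - (7 / 5 / b * (7 / 5 / b * b ^+ 2))) =
    pos_sq y + b ^+ 2 + 14 / 5 * b + 49 / 25 by field; rewrite gt_eqF.
move: (pos_sq y) a0 => a a0 h.
(* Now [a + (b + 7/5)^2 <= 4], so [b <= 3/5]. Bounding [a] by this makes each ellipse condition a
   convex quadratic in [b], below 1 at both ends of its range, [[0, 3/10]] or [[3/10, 3/5]]. *)
have [b3|b3] := leP b (3 / 10).
  left; nra.
right; nra.
Qed.

Lemma high_dimension n : (2000 <= n)%N -> exists K : set 'rV[R]_n,
  constant_width 2 K /\ (vol K <= (2 * (39 / 40) ^+ n)%:E * bvol n 1)%E.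
Proof.
move=> n2000.
have [K [LK dK cK]] := complete2_exists (@orthant_cap_diam n).
exists K; split.
  apply: complete2_constant_width => //; first exact: leq_trans n2000.
  exists 0; apply: LK; split; first by move=> i; rewrite mxE.
  by rewrite /dotv big1// => i _; rewrite mxE mul0r.
pose w1 (t : R) := stretch (3/2) (9/20) t ^+ 2.
pose w2 (t : R) := stretch (5/4) (7/10) t ^+ 2.
have mw (A B : R) : measurable_fun setT (fun t : R => stretch A B t ^+ 2).
  apply: (@measurableT_comp _ _ _ _ _ _ (fun t : R => t ^+ 2)).
    exact: exprn_measurable.
  exact: measurable_stretch.
apply: (@le_trans _ _ (vol [set x : 'rV[R]_n | wsum w1 x <= 1 \/ wsum w2 x <= 1])).
  apply: vol_le => y Ky; apply: orthant_cap_hull => // x Lx.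
  by apply: dK => //; exact: LK.
apply: le_trans (vol_wsum_union _ _ _ (mw _ _) (mw _ _)) _.
rewrite !wvol_stretch//.
rewrite (_ : (3 / 2 + 9 / 20) / 2 = 39 / 40 :> R); last by field.
rewrite (_ : (5 / 4 + 7 / 10) / 2 = 39 / 40 :> R); last by field.
rewrite -ge0_muleDl ?lee_fin ?exprn_ge0// -EFinD.
by rewrite [X in (X%:E * _ <= _)%E](_ : _ = 2 * (39 / 40) ^+ n) ?lexx//; ring.
Qed.

End HighDimension.

(** * Low dimension *)

Section LowDimension.
Variable R : realType.

(** The height [sqrt 3] puts the apex at distance exactly 2 from the unit sphere at height 0. *)
Definition apex m : 'rV[R]_m.+2 := Num.sqrt 3 *: delta_mx ord0 ord_max.

Definition reuleaux_points m : set 'rV[R]_m.+2 :=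
  [set x : 'rV[R]_m.+2 | x = apex m \/ x ord0 ord_max = 0 /\ dotv x x = 1].

Lemma sqdist_apex m (x : 'rV[R]_m.+2) :
  sqdist x (apex m) = off_axis x + (x ord0 ord_max - Num.sqrt 3) ^+ 2.
Proof.
rewrite /sqdist /apex !dotvE (dotvC _ x) !dotv_delta mxE !eqxx/= /off_axis.
ring.
Qed.

Lemma reuleaux_points_diam m : diam_le2 (@reuleaux_points m).
Proof.
have base (x : 'rV[R]_m.+2) : x ord0 ord_max = 0 /\ dotv x x = 1 ->
    sqdist x (apex m) = 4.
  move=> [xm xx]; rewrite sqdist_apex /off_axis xx xm sub0r sqrrN sqr_sqrtr//; ring.
move=> x y [->|hx] [->|hy].
- by rewrite sqdistxx.
- by rewrite sqdistC base.
- by rewrite base.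
- have := dotv_ge0 (x + y); rewrite /sqdist !dotvE (dotvC y x).
  case: hx => _ ->; case: hy => _ ->; lra.
Qed.

(** The apex gives the lower end of the chord; the point of the sphere farthest from [y] gives the
    upper end. *)
Lemma reuleaux_hull m (y : 'rV[R]_m.+2) :
  (forall x, @reuleaux_points m x -> sqdist y x <= 4) ->
  reuleaux_chord (0 + off_axis y) (y ord0 ord_max).
Proof.
move=> hy; rewrite add0r; pose t := y ord0 ord_max.
pose e : 'rV[R]_m.+2 := delta_mx ord0 ord_max.
have ee : dotv e e = 1 by rewrite dotv_delta mxE !eqxx.
have ye : dotv y e = t by rewrite dotv_delta.
pose y' := y - t *: e.
have y'e : dotv y' e = 0 by rewrite /y' !dotvE ye ee; ring.
have s_def : off_axis y = dotv y' y'.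
  by rewrite /off_axis -/t /y' !dotvE (dotvC e y) ye ee; ring.
have yE : y = t *: e + y' by rewrite /y' addrC subrK.
clearbody y'.
have s0 : 0 <= off_axis y by rewrite s_def dotv_ge0.
have le_sqrt (a b : R) : a ^+ 2 <= b -> a <= Num.sqrt b.
  move=> ab; apply: le_trans (ler_norm _) _.
  by rewrite -sqrtr_sqr ler_wsqrtr.
rewrite /reuleaux_chord /= in_itv/=; apply/andP; split.
  have := hy (apex m); rewrite sqdist_apex => /(_ (or_introl erefl)) h.
  rewrite lerBlDr -lerBlDl; apply: le_sqrt; rewrite -sqrrN opprB; lra.
apply: le_sqrt; rewrite -/t.
pose b := Num.sqrt (off_axis y).
have bb : b ^+ 2 = dotv y' y' by rewrite sqr_sqrtr// s_def.
(* The farthest point is opposite to the radial part [y']. If [y] is on the axis, any unit vector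
   orthogonal to [e] will do; the dimension [m.+2] provides one. *)
have [u [ue uu yu]] : exists u, [/\ dotv u e = 0, dotv u u = 1 & dotv y' u = - b].
  have [sE|sN] := eqVneq (off_axis y) 0.
    pose u : 'rV[R]_m.+2 := delta_mx ord0 ord0.
    have y'0 : y' = 0.
      apply/rowP => i; rewrite [RHS]mxE; apply/eqP; rewrite -sqrf_eq0.
      apply/eqP/le_anti; rewrite sqr_ge0 andbT -sE s_def /dotv (bigD1 i)//=.
      rewrite -expr2 lerDl; apply: sumr_ge0 => j _; rewrite -expr2; exact: sqr_ge0.
    exists u; split.
    - by rewrite dotv_delta mxE.
    - by rewrite dotv_delta mxE !eqxx.
    - by rewrite /b sE sqrtr0 oppr0 y'0 -(scale0r u) dotvZl mul0r.
  have bpos : 0 < b by rewrite sqrtr_gt0 lt_neqAle eq_sym sN.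
  exists (- b^-1 *: y'); split.
  - by rewrite dotvZl y'e mulr0.
  - by rewrite !dotvE -bb; field; rewrite gt_eqF.
  - by rewrite !dotvE -bb; field; rewrite gt_eqF.
have := hy u; rewrite /sqdist (_ : y - u = t *: e + (y' - u)); last first.
  by rewrite {1}yE addrA.
rewrite !dotvE (dotvC e y') (dotvC e u) (dotvC u y').
rewrite ee y'e ue uu yu -bb /b.
move=> h; suff : @reuleaux_points m u by move=> /h; rewrite -/b; lra.
by right; split => //; rewrite -dotv_delta.
Qed.

Lemma low_dimension m : exists K : set 'rV[R]_m.+2,
  constant_width 2 K /\ (vol K < bvol m.+2 1)%E.
Proof.
have [K [LK dK cK]] := complete2_exists (@reuleaux_points_diam m).
exists K; split.
  by apply: complete2_constant_width => //; exists (apex m); apply: LK; left.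
rewrite -vol_unit_eball; apply: le_lt_trans (axial_vol_reuleaux_lt R m).
apply: vol_le => y Ky; apply: reuleaux_hull => x Lx.
by apply: dK => //; exact: LK.
Qed.

End LowDimension.

(** * From volumes to effective radii *)

Lemma bernoulli_ineq (R : realType) (x : R) n : 0 <= x ->
  1 + n%:R * x <= (1 + x) ^+ n.
Proof.
move=> x0; elim: n => [|n IH]; first by rewrite mul0r addr0 expr0.
rewrite exprS -natr1.
have : 0 <= n%:R :> R by [].
nra.
Qed.

Lemma min_effective_radius_le (R : realType) n (K : set 'rV[R]_n) :
  (0 < n)%N -> constant_width 2 K -> (vol K < +oo)%E ->
  exists r, [/\ 0 <= r, ((r ^+ n)%:E * bvol n 1 = vol K)%E &
    min_effective_radius R n <= r].
Proof.
move=> n0 wK Kfin; have [r rK rE] := effective_radius_exists n0 Kfin.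
exists r; split => //; first by case: rK.
apply: ge_inf; last by exists K.
by exists 0 => s [K' [_ []]].
Qed.

(** The rate [39/40] is relaxed to [79/80] to absorb the factor 2: the ratio is [1 + 1/78], and its
    [n]-th power exceeds 2 by Bernoulli. *)
Lemma min_effective_radius_high (R : realType) n : (2000 <= n)%N ->
  min_effective_radius R n <= 1 - 1 / 80.
Proof.
move=> n2000; have n0 : (0 < n)%N by exact: leq_trans n2000.
have [K [wK volK]] := @high_dimension R n n2000.
have Kfin : (vol K < +oo)%E.
  apply: le_lt_trans volK _; rewrite lte_mul_pinfty ?bvol_fin//.
have [r [r0 rE]] := min_effective_radius_le n0 wK Kfin; move=> /le_trans; apply.
move: volK; rewrite -rE; have := @bvol_fin R n 1; have := @bvol_gt0 R n 1 ltr01.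
case: (bvol n 1) => // b; rewrite lte_fin => b0 _.
rewrite -!EFinM lee_fin ler_pM2r// => rn.
rewrite leNgt; apply/negP => r_gt.
have : (79 / 80) ^+ n <= r ^+ n by rewrite lerXn2r// ?nnegrE; lra.
have -> : 79 / 80 = (39 / 40) * (1 + 1 / 78) :> R by field.
rewrite exprMn.
have bern : 2 < (1 + 1 / 78 : R) ^+ n.
  apply: lt_le_trans (bernoulli_ineq n _); last by lra.
  have : 2000%:R <= n%:R :> R by rewrite ler_nat.
  lra.
have : 0 < (39 / 40 : R) ^+ n by rewrite exprn_gt0.
nra.
Qed.

Lemma min_effective_radius_low (R : realType) n : (2 <= n)%N ->
  min_effective_radius R n < 1.
Proof.
case: n => [|[|m]]// _; have [K [wK volK]] := low_dimension R m.
have Kfin : (vol K < +oo)%E by rewrite (lt_trans volK) ?bvol_fin.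
have [r [r0 rE]] := min_effective_radius_le (ltn0Sn _) wK Kfin; move=> /le_lt_trans; apply.
move: volK; rewrite -rE; have := @bvol_fin R m.+2 1; have := @bvol_gt0 R m.+2 1 ltr01.
case: (bvol m.+2 1) => // b; rewrite lte_fin => b0 _.
rewrite -!EFinM lte_fin gtr_pMl// => rn.
by rewrite ltNge; apply: contraTN rn => r1; rewrite -leNgt exprn_ege1.
Qed.

Theorem corollary4 (R : realType) :
  exists eps : R, 0 < eps /\
    forall n : nat, (2 <= n)%N -> min_effective_radius R n <= 1 - eps.
Proof.
(* Finitely many dimensions remain; [e] is built as a minimum of their positive gaps, by induction
   on the upper bound. *)
have [e [e0 he]] : exists e : R, 0 < e /\ forall n, (2 <= n < 2000)%N ->
    min_effective_radius R n <= 1 - e.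
  elim: 2000%N => [|N [e [e0 he]]]; first by exists 1; split => // n; rewrite andbF.
  have [N2|N2] := leqP 2 N; last first.
    exists 1; split => // n /andP[n2 nN].
    by have := leq_ltn_trans (nN : (n <= N)%N) N2; rewrite ltnNge n2.
  exists (Num.min e (1 - min_effective_radius R N)); split.
    by rewrite lt_min e0 subr_gt0 min_effective_radius_low.
  move=> n /andP[n2]; rewrite ltnS leq_eqVlt => /predU1P[->|nN].
    by rewrite lerBrDl -lerBrDr ge_min lexx orbT.
  rewrite (le_trans (he n _)) ?n2// lerD2l lerN2 ge_min lexx//.
exists (Num.min e (1 / 80)); split; first by rewrite lt_min e0; lra.
move=> n n2; have [n2000|n2000] := leqP 2000 n.
  apply: le_trans (min_effective_radius_high R n2000) _.
  by rewrite lerD2l lerN2 ge_min lexx orbT.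
by rewrite (le_trans (he n _)) ?n2// lerD2l lerN2 ge_min lexx.
Qed.
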